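(* For $k\ge1$ consider the elements of $\mathrm{Lie}(\mathbb{H})$ $$W_k=\Big(\sum_{j=1}^k j^{-3}\Big)^{-1/2}\sum_{j=1}^k\frac{e^1_j}{j},\qquad W_\infty=\Big(\sum_{j=1}^\infty j^{-3}\Big)^{-1/2}\sum_{j=1}^\infty\frac{e^1_j}{j},$$ where, for each $k\ge 1$, $W_k$ and $e^3$ are orthonormal with respect to $\langle\cdot,\cdot\rangle_\sigma$. Then, as $k\to\infty$, the subspace $\mathrm{span}\{W_k,e^3\}$ converges to $\mathrm{span}\{W_\infty,e^3\}$ in the Grassmannian of 2-dimensional planes contained in $\mathrm{Lie}(\mathbb{H})$, and the sectional curvatures $K_\sigma(W_k,e^3)$ (which are defined for every $k\ge1$) satisfy $$K_\sigma(W_k,e^3)\to+\infty\quad\text{as }k\to\infty.$$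
   Context: $\ell^2$ is the Hilbert space of real square-summable sequences with its standard scalar product $\langle\cdot,\cdot\rangle$ and canonical orthonormal basis $(e_j)_{j\ge1}$. The infinite dimensional Heisenberg group $\mathbb{H}$ is the Hilbert space $\ell^2\times\ell^2\times\mathbb{R}$ equipped with the Lie group operation $$(h_1,h_2,\tau)(h_1',h_2',\tau')=(h_1+h_1',\,h_2+h_2',\,\tau+\tau'+\langle h_1,h_2'\rangle-\langle h_2,h_1'\rangle).$$ Its Lie algebra $\mathrm{Lie}(\mathbb{H})$ (left invariant vector fields) is identified with $T_0\mathbb{H}=\ell^2\times\ell^2\times\mathbb{R}$, with Lie product $$[(h_1,h_2,\tau),(h_1',h_2',\tau')]=2\big(\langle h_1,h_2'\rangle-\langle h_2,h_1'\rangle\big)\,(0,0,1).$$ Notation: $e^1_j=(e_j,0,0)$, $e^2_j=(0,e_j,0)$, $e^3=(0,0,1)$. The metric $\sigma$: let $A:\ell^2\to\ell^2$ be the continuous linear operator $(Ax)_k=x_k/k$, $k\ge1$. The left invariant weak Riemannian metric $\sigma$ is the one given at the identity by the scalar product $$\sigma_0((v_1,v_2,v_3),(w_1,w_2,w_3))=\langle Av_1,w_1\rangle+\langle Av_2,w_2\rangle+v_3w_3.$$ The corresponding scalar product on $\mathrm{Lie}(\mathbb{H})$ is $\langle\cdot,\cdot\rangle_\sigma=\sigma_0$. Sectional curvature: for $X,Y\in\mathrm{Lie}(\mathbb{H})$, let $B_\sigma(X,Y)=\mathrm{ad}(Y)^*(X)$ denote the (unique, if it exists) element of $\mathrm{Lie}(\mathbb{H})$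 such that $\langle[Y,Z],X\rangle_\sigma=\langle Z,B_\sigma(X,Y)\rangle_\sigma$ for all $Z\in\mathrm{Lie}(\mathbb{H})$. Since $\sigma$ is only a weak metric, $B_\sigma(X,Y)$ need not exist. For $X,Y$ orthonormal with respect to $\langle\cdot,\cdot\rangle_\sigma$ such that $B_\sigma(X,Y)$, $B_\sigma(Y,X)$, $B_\sigma(X,X)$, $B_\sigma(Y,Y)$ exist, the sectional curvature of the plane spanned by $X,Y$ is defined (Arnold's formula) as $$K_\sigma(X,Y)=\langle\delta,\delta\rangle_\sigma+2\langle\alpha,\beta\rangle_\sigma-3\langle\alpha,\alpha\rangle_\sigma-4\langle B_X,B_Y\rangle_\sigma,$$ where $\delta=\frac12(B_\sigma(X,Y)+B_\sigma(Y,X))$, $\beta=\frac12(B_\sigma(X,Y)-B_\sigma(Y,X))$, $\alpha=\frac12[X,Y]$, $B_X=\frac12B_\sigma(X,X)$, $B_Y=\frac12B_\sigma(Y,Y)$. Convergence in the Grassmannian of 2-dimensional subspaces refers to the usual topology for the Hilbert space $\ell^2\times\ell^2\times\mathbb{R}$: subspaces $V_k$ converge to $V$ when the orthogonal projections (for the standard Hilbert product) onto $V_k$ converge in operator norm to the orthogonal projection onto $V$. *)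

(* Defs.v *)
From HB Require Import structures.
From mathcomp Require Import all_boot all_order all_algebra.
From mathcomp Require Import all_classical all_reals all_analysis.
From mathcomp Require Import ring.

Set Implicit Arguments.
Unset Strict Implicit.
Unset Printing Implicit Defensive.

Import Order.TTheory GRing.Theory Num.Theory.
Import numFieldNormedType.Exports.

Local Open Scope classical_set_scope.
Local Open Scope ring_scope.

(* Coordinates are numbered from 0: [x i] is the mathematical x_{i+1},
   and [l2_basis j] is e_{j+1}. *)

Section L2.
Context {R : realType}.

Definition square_summable : {pred nat -> R^o} :=
  [pred x : nat -> R^o | `[< cvgn (series (fun i => x i ^+ 2 : R)) >] ].

Lemma square_summableP (x : nat -> R^o) :
  reflect (cvgn (series (fun i => x i ^+ 2 : R))) (x \in square_summable).
Proof. exact: asboolP. Qed.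

Lemma square_summable_submod_closed : submod_closed square_summable.
Proof.
split=> [|a x y /square_summableP xl2 /square_summableP yl2].
  apply/square_summableP.
  rewrite (_ : series _ = fun=> 0); first exact: is_cvg_cst.
  apply/funext => n; rewrite /series /=.
  by rewrite big1// => i _; rewrite expr0n.
apply/square_summableP.
have dom_cvg := is_cvg_seriesZ (k := 2)
  (is_cvg_seriesD (is_cvg_seriesZ (k := a ^+ 2) xl2) yl2).
apply: (series_le_cvg _ _ _ dom_cvg) => i; first exact: sqr_ge0.
  change (0 <= 2 * (a ^+ 2 * x i ^+ 2 + y i ^+ 2)).
  apply: mulr_ge0 => //; apply: addr_ge0; last exact: sqr_ge0.
  by apply: mulr_ge0; exact: sqr_ge0.
change ((a * x i + y i) ^+ 2 <= 2 * (a ^+ 2 * x i ^+ 2 + y i ^+ 2)).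
rewrite -subr_ge0 (_ : _ - _ = (a * x i - y i) ^+ 2) ?sqr_ge0//.
by ring.
Qed.

HB.instance Definition _ := GRing.isSubmodClosed.Build R (nat -> R^o)
  square_summable square_summable_submod_closed.

Record l2 := L2 {
  l2val :> nat -> R^o;
  l2valP : l2val \in square_summable }.

HB.instance Definition _ := [isSub for l2val].
HB.instance Definition _ := [Choice of l2 by <:].
HB.instance Definition _ := [SubChoice_isSubLmodule of l2 by <:].

Definition l2_dot (x y : l2) : R := limn (series (fun i => x i * y i : R)).

Lemma l2_basis_subproof (j : nat) :
  (fun i => (i == j)%:R : R^o) \in square_summable.
Proof.
apply/square_summableP.
rewrite -(is_cvg_series_restrict j.+1).
rewrite (_ : mk_sequence _ = fun=> 0); first exact: is_cvg_cst.
apply/funext => n /=; rewrite big_nat_cond big1// => i /andP[/andP[ji _] _].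
by rewrite gtn_eqF// expr0n.
Qed.

Definition l2_basis (j : nat) : l2 := L2 (l2_basis_subproof j).

Lemma opA_subproof (x : l2) :
  (fun i => x i / i.+1%:R : R^o) \in square_summable.
Proof.
apply/square_summableP.
have /square_summableP xl2 := l2valP x.
apply: (series_le_cvg _ _ _ xl2) => i; rewrite ?sqr_ge0//.
rewrite expr_div_n ler_pdivrMr ?exprn_gt0//.
by rewrite ler_peMr ?sqr_ge0// exprn_ege1// ler1n.
Qed.

Definition opA (x : l2) : l2 := L2 (opA_subproof x).

End L2.

Arguments l2 R : clear implicits.

(* Lie(H) = T_0 H, as a vector space; its Hilbert product is [hdot] below. *)
Definition lieH (R : realType) : lmodType R := (l2 R * l2 R * R^o)%type.

Section Heisenberg.
Context {R : realType}.

Definition e1 (j : nat) : lieH R := (l2_basis j, 0, 0).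
Definition e3 : lieH R := (0, 0, 1).

Definition bracket (X Y : lieH R) : lieH R :=
  (2 * (l2_dot X.1.1 Y.1.2 - l2_dot X.1.2 Y.1.1)) *: e3.

Definition hdot (X Y : lieH R) : R :=
  l2_dot X.1.1 Y.1.1 + l2_dot X.1.2 Y.1.2 + X.2 * Y.2.

Definition hnorm (X : lieH R) : R := Num.sqrt (hdot X X).

Definition sigma (X Y : lieH R) : R :=
  l2_dot (opA X.1.1) Y.1.1 + l2_dot (opA X.1.2) Y.1.2 + X.2 * Y.2.

Definition sigma_orthonormal (X Y : lieH R) : Prop :=
  [/\ sigma X X = 1, sigma Y Y = 1 & sigma X Y = 0].

(* [is_B X Y b] : b is the element B_sigma(X,Y) = ad(Y)^*(X). *)
Definition is_B (X Y b : lieH R) : Prop :=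
  forall Z, sigma (bracket Y Z) X = sigma Z b.

Definition B_exists (X Y : lieH R) : Prop := exists b, is_B X Y b.

(* Meaningful only under [B_exists X Y]; the default value 0 is junk. *)
Definition B (X Y : lieH R) : lieH R := xget 0 [set b | is_B X Y b].

Definition sectional_curvature_defined (X Y : lieH R) : Prop :=
  sigma_orthonormal X Y /\
  [/\ B_exists X Y, B_exists Y X, B_exists X X & B_exists Y Y].

(* Arnold's formula; meaningful only under [sectional_curvature_defined]. *)
Definition sectional_curvature (X Y : lieH R) : R :=
  let delta := 2^-1 *: (B X Y + B Y X) in
  let beta := 2^-1 *: (B X Y - B Y X) in
  let alpha := 2^-1 *: bracket X Y in
  let BX := 2^-1 *: B X X in
  let BY := 2^-1 *: B Y Y in
  sigma delta delta + 2 * sigma alpha beta - 3 * sigma alpha alpha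
    - 4 * sigma BX BY.

Definition span2 (X Y : lieH R) : set (lieH R) :=
  [set Z | exists a b : R, Z = a *: X + b *: Y].

Definition lin_indep2 (X Y : lieH R) : Prop :=
  forall a b : R, a *: X + b *: Y = 0 -> a = 0 /\ b = 0.

Definition Gr2 : set (set (lieH R)) :=
  [set V | exists X Y, lin_indep2 X Y /\ V = span2 X Y].

Definition is_orthoproj (V : set (lieH R)) (P : lieH R -> lieH R) : Prop :=
  forall x, V (P x) /\ forall v, V v -> hdot (x - P x) v = 0.

Definition opnorm (T : lieH R -> lieH R) : \bar R :=
  ereal_sup [set (hnorm (T x))%:E | x in [set x | hnorm x <= 1]].

Definition Gr2_cvg (V : nat -> set (lieH R)) (V0 : set (lieH R)) : Prop :=
  [/\ forall k, Gr2 (V k), Gr2 V0 &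
  exists (P : nat -> lieH R -> lieH R) (P0 : lieH R -> lieH R),
    [/\ forall k, is_orthoproj (V k) (P k), is_orthoproj V0 P0 &
        opnorm (fun x => P k x - P0 x) @[k --> \oo] --> 0%E]].

(* Sum of a series in Hilbert norm; the default value 0 is junk if the
   series diverges. *)
Definition hsum (u : nat -> lieH R) : lieH R :=
  xget 0 [set s | hnorm (\sum_(0 <= j < n) u j - s) @[n --> \oo] --> (0 : R)].

Definition W (k : nat) : lieH R :=
  (Num.sqrt (\sum_(0 <= j < k) j.+1%:R ^- 3))^-1 *:
    \sum_(0 <= j < k) j.+1%:R^-1 *: e1 j.

Definition Winfty : lieH R :=
  (Num.sqrt (limn (series (fun j => j.+1%:R ^- 3 : R))))^-1 *:
    hsum (fun j => j.+1%:R^-1 *: e1 j).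

End Heisenberg.

Arguments e1 R j : clear implicits.
Arguments e3 R : clear implicits.
Arguments W R k : clear implicits.
Arguments Winfty R : clear implicits.

(* Main.v *)
(* Since [e3] is central, [B(e3,W_k) = (0, 2 A^-1 w_k, 0)] (with [w_k] the first
   component of [W_k]) is the only nonzero B-term in Arnold's formula, so that
   [K(W_k,e3) = <A^-1 w_k, w_k> = (sum_(j<=k) 1/j) / (sum_(j<=k) j^-3)], which
   diverges with the harmonic series. On the other hand [span(W_k,e3)] is
   also spanned by [e3] and the truncation to k terms of the square-summable
   sequence [1/j]; the truncations converge, hence so do the projections. *)
Require Import Defs.
From mathcomp Require Import all_boot all_order all_algebra.
From mathcomp Require Import all_classical all_reals all_analysis.
From mathcomp Require Import ring lra.

Import Order.TTheory GRing.Theory Num.Theory.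
Import numFieldNormedType.Exports.

Local Open Scope classical_set_scope.
Local Open Scope ring_scope.

(** * The scalar product of l^2 *)

Section L2Dot.
Context {R : realType}.
Implicit Types x y z : l2 R.

(** Absolute convergence by comparison, from |ab| <= a^2 + b^2. It makes the limit in [l2_dot] a
    genuine one, on which the linearity lemmas below rest. *)
Lemma is_cvg_l2_dot x y : cvgn (series (fun i => x i * y i : R)).
Proof.
have /square_summableP xx := l2valP x; have /square_summableP yy := l2valP y.
apply: normed_cvg.
apply: (series_le_cvg _ _ _ (is_cvg_seriesD xx yy)) => i //=.
  change (0 <= x i ^+ 2 + y i ^+ 2 :> R); apply: addr_ge0; exact: sqr_ge0.
change (`|x i * y i| <= x i ^+ 2 + y i ^+ 2 :> R).
move: (x i : R) (y i : R) => a b.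
have := sqr_ge0 (a - b); have := sqr_ge0 (a + b).
by have := sqr_ge0 a; have := sqr_ge0 b; case: (ger0P (a * b)) => _; nra.
Qed.

Lemma l2_dotC x y : l2_dot x y = l2_dot y x.
Proof.
by rewrite /l2_dot; congr (limn (series _)); apply/funext => i; rewrite mulrC.
Qed.

Lemma l2_dotDl x y z : l2_dot (x + y) z = l2_dot x z + l2_dot y z.
Proof.
rewrite /l2_dot -(lim_seriesD (is_cvg_l2_dot x z) (is_cvg_l2_dot y z)).
congr (limn (series _)); apply/funext => i.
by change ((x i + y i) * z i = x i * z i + y i * z i :> R); rewrite mulrDl.
Qed.

Lemma l2_dotZl (a : R) x y : l2_dot (a *: x) y = a * l2_dot x y.
Proof.
rewrite /l2_dot -[RHS](lim_seriesZ a (is_cvg_l2_dot x y)).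
congr (limn (series _)); apply/funext => i.
by change (a * x i * y i = a * (x i * y i) :> R); rewrite mulrA.
Qed.

Lemma l2_dot0l y : l2_dot 0 y = 0.
Proof. by rewrite -(scale0r (0 : l2 R)) l2_dotZl mul0r. Qed.

Lemma l2_dot0r x : l2_dot x 0 = 0.
Proof. by rewrite l2_dotC l2_dot0l. Qed.

(** The partial sums increase to the limit, and the one of length [i.+1] contains the i-th square.
    Positivity and definiteness both follow from this. *)
Lemma l2_dotxx_ge_sqr x i : x i ^+ 2 <= l2_dot x x.
Proof.
have nd : nondecreasing_seq (series (fun i => x i * x i : R)).
  by apply: nondecreasing_series => j _ _; rewrite -expr2 sqr_ge0.
apply: le_trans (nondecreasing_cvgn_le nd (is_cvg_l2_dot x x) i.+1).
rewrite seriesSr expr2 lerDr; apply: sumr_ge0 => j _.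
by rewrite -expr2 sqr_ge0.
Qed.

Lemma l2_dotxx_ge0 x : 0 <= l2_dot x x.
Proof. by apply: le_trans (l2_dotxx_ge_sqr x 0); exact: sqr_ge0. Qed.

Lemma l2P x y : (forall i, x i = y i) -> x = y.
Proof. by move=> xy; apply: val_inj; apply/funext => i; exact: xy. Qed.

Lemma l2_dotxx_eq0 x : l2_dot x x = 0 -> x = 0.
Proof.
move=> x0; apply: l2P => i; have := l2_dotxx_ge_sqr x i.
by rewrite x0 => h; apply/eqP; rewrite -sqrf_eq0 eq_le h sqr_ge0.
Qed.

Lemma l2_dot_finite k x y : (forall i, (k <= i)%N -> x i * y i = 0) ->
  l2_dot x y = \sum_(0 <= i < k) x i * y i.
Proof.
move=> xy0; apply: lim_near_cst => //; exists k => // n /= kn.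
rewrite /series /= (big_cat_nat (n := k))//= [X in _ + X]big_nat_cond.
by rewrite [X in _ + X]big1 ?addr0// => i /andP[/andP[ki _] _]; exact: xy0.
Qed.

Lemma l2_sumE (F : nat -> l2 R) k i :
  (\sum_(0 <= j < k) F j) i = \sum_(0 <= j < k) (F j i : R).
Proof.
elim: k => [|k IH]; first by rewrite !big_nil.
by rewrite [RHS]big_nat_recr// -IH big_nat_recr.
Qed.

Lemma l2_sum_basisE (a : nat -> R) k i :
  (\sum_(0 <= j < k) a j *: l2_basis j) i = if (i < k)%N then a i else 0.
Proof.
rewrite l2_sumE; under eq_bigr => j _.
  change ((a j *: l2_basis j : l2 R) i) with (a j * (i == j)%:R); over.
elim: k => [|k IH]; first by rewrite big_nil.
rewrite big_nat_recr//= IH ltnS [(i <= k)%N]leq_eqVlt.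
by case: eqVneq => [->|_]; rewrite ?ltnn/= ?mulr1 ?mulr0 ?add0r ?addr0.
Qed.

End L2Dot.

(** * The Hilbert product of Lie(H) and limits in norm *)

Section HDot.
Context {R : realType}.
Implicit Types X Y Z : lieH R.

Lemma hdotC X Y : hdot X Y = hdot Y X.
Proof. by rewrite /hdot (l2_dotC X.1.1) (l2_dotC X.1.2) (mulrC X.2). Qed.

Lemma hdotDl X Y Z : hdot (X + Y) Z = hdot X Z + hdot Y Z.
Proof. by rewrite /hdot /= !l2_dotDl; ring. Qed.

Lemma hdotZl (a : R) X Y : hdot (a *: X) Y = a * hdot X Y.
Proof.
by rewrite /hdot /= !l2_dotZl; change (a *: X.2) with (a * X.2); ring.
Qed.

Lemma hdotNl X Y : hdot (- X) Y = - hdot X Y.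
Proof. by rewrite -scaleN1r hdotZl mulN1r. Qed.

Lemma hdotDr X Y Z : hdot X (Y + Z) = hdot X Y + hdot X Z.
Proof. by rewrite !(hdotC X) hdotDl. Qed.

Lemma hdotZr (a : R) X Y : hdot X (a *: Y) = a * hdot X Y.
Proof. by rewrite !(hdotC X) hdotZl. Qed.

Lemma hdotNr X Y : hdot X (- Y) = - hdot X Y.
Proof. by rewrite !(hdotC X) hdotNl. Qed.

Definition hdotE := (hdotDl, hdotDr, hdotNl, hdotNr, hdotZl, hdotZr).

Lemma hdotxx_ge0 X : 0 <= hdot X X.
Proof. by rewrite !addr_ge0 ?l2_dotxx_ge0// -expr2 sqr_ge0. Qed.

Lemma hdotxx_eq0 X : hdot X X = 0 -> X = 0.
Proof.
case: X => -[x y] t; rewrite /hdot/= => h.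
have x0 := l2_dotxx_ge0 x; have y0 := l2_dotxx_ge0 y.
have t0 : 0 <= (t : R) * t by rewrite -expr2 sqr_ge0.
rewrite (@l2_dotxx_eq0 _ x); last by lra.
rewrite (@l2_dotxx_eq0 _ y); last by lra.
have /eqP : (t : R) * t = 0 by lra.
by rewrite mulf_eq0 orbb => /eqP ->.
Qed.

(** The squared norm of <Y,Y> X - <X,Y> Y expands to <Y,Y> (<X,X> <Y,Y> - <X,Y>^2), and the first
    factor can be cancelled when Y is nonzero. *)
Lemma hdot_Cauchy_Schwarz X Y : hdot X Y ^+ 2 <= hdot X X * hdot Y Y.
Proof.
have hY0 Z : hdot Z 0 = 0 by rewrite -(scale0r Z) hdotZr mul0r.
have [/hdotxx_eq0 ->|Y0] := eqVneq (hdot Y Y) 0.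
  by rewrite !hY0 expr0n/= mulr0.
have {Y0} : 0 < hdot Y Y by rewrite lt_neqAle eq_sym Y0 hdotxx_ge0.
have := hdotxx_ge0 (hdot Y Y *: X - hdot X Y *: Y); rewrite !hdotE (hdotC Y X).
move: (hdot X X) (hdot Y Y) (hdot X Y) => p q r h q0.
by rewrite -subr_ge0 -(pmulr_rge0 _ q0); move: h; congr (0 <= _); ring.
Qed.

Lemma hnorm_cvg0 (u : nat -> lieH R) :
  hnorm (u n) @[n --> \oo] --> (0 : R) <->
  hdot (u n) (u n) @[n --> \oo] --> (0 : R).
Proof.
split=> u0.
  rewrite (_ : (fun n => _) = fun n => hnorm (u n) * hnorm (u n)).
    by rewrite -(mulr0 (0 : R)); exact: cvgM.
  by apply/funext => n; rewrite -expr2 sqr_sqrtr ?hdotxx_ge0.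
rewrite -(@sqrtr0 R); apply: continuous_cvg => //; exact: sqrt_continuous.
Qed.

(** By the parallelogram law, half of |X - Y|^2 is at most |u_n - X|^2 + |u_n - Y|^2, which tends to
    0. *)
Lemma hnorm_limit_unique (u : nat -> lieH R) X Y :
  hnorm (u n - X) @[n --> \oo] --> (0 : R) ->
  hnorm (u n - Y) @[n --> \oo] --> (0 : R) -> X = Y.
Proof.
move=> /hnorm_cvg0 uX /hnorm_cvg0 uY.
apply/eqP; rewrite -subr_eq0; apply/eqP/hdotxx_eq0/le_anti.
rewrite hdotxx_ge0 andbT -(@pmulr_rle0 _ 2^-1) ?invr_gt0//.
rewrite -(addr0 (0 : R)); apply: cvgr_to_ge (cvgD uX uY) _.
apply: nearW => n; have := hdotxx_ge0 ((u n - X) + (u n - Y)).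
by rewrite fctE !hdotE (hdotC X (u n)) (hdotC Y (u n)) (hdotC Y X); lra.
Qed.

(** [hsum] is a choice among the limits: as soon as one exists the chosen value is a limit, and
    uniqueness identifies it. *)
Lemma hsum_eq (u : nat -> lieH R) X :
  hnorm (\sum_(0 <= j < n) u j - X) @[n --> \oo] --> (0 : R) -> hsum u = X.
Proof.
move=> uX; apply: hnorm_limit_unique (uX).
exact: (@xgetPex _ 0 [set s | hnorm (\sum_(0 <= j < n) u j - s)
  @[n --> \oo] --> (0 : R)] (ex_intro _ X uX)).
Qed.

End HDot.

(** * Planes, orthogonal projections and the operator norm *)

Section Planes.
Context {R : realType}.
Implicit Types X Y E x : lieH R.

Lemma span2Zl (a : R) X Y : a != 0 -> span2 (a *: X) Y = span2 X Y.
Proof.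
move=> a0; apply/seteqP; split=> _ [b [c ->]].
  by exists (b * a), c; rewrite scalerA.
by exists (b / a), c; rewrite scalerA divfK.
Qed.

Lemma orthogonal_lin_indep2 X E :
  hdot X X != 0 -> hdot E E = 1 -> hdot X E = 0 -> lin_indep2 X E.
Proof.
move=> X0 E1 XE a b h.
have hX : hdot (a *: X + b *: E) X = a * hdot X X.
  by rewrite !hdotE (hdotC E) XE mulr0 addr0.
have hE : hdot (a *: X + b *: E) E = b.
  by rewrite !hdotE XE E1 mulr0 add0r mulr1.
have hY0 Z : hdot 0 Z = 0 by rewrite -(scale0r Z) hdotZl mul0r.
move: hX hE; rewrite h !hY0 => /esym/eqP; rewrite mulf_eq0 (negPf X0) orbF.
by move=> /eqP -> <-.
Qed.

(** Only [E] is meant to be a unit vector. Dividing by <X,X> avoids normalising [X], so the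
    truncations of 1/j can be used as they are. *)
Definition orthoproj2 X E x : lieH R :=
  (hdot x X / hdot X X) *: X + hdot x E *: E.

Lemma orthoproj2P X E : hdot X X != 0 -> hdot E E = 1 -> hdot X E = 0 ->
  is_orthoproj (span2 X E) (orthoproj2 X E).
Proof.
move=> X0 E1 XE x; split=> [|_ [a [b ->]]]; first by eexists; eexists.
by rewrite /orthoproj2 !hdotE (hdotC E X) XE E1; field.
Qed.

(* The two projections differ by [p U - q w] with U and w orthogonal, and its
   squared norm is (a^2 d / u + b^2) / (u + d), for u = <U, U>, d = <w, w>,
   a = <x, U>, b = <x, w>; Cauchy-Schwarz bounds a and b. *)
Lemma orthoproj2_diff_le U w E x : 0 < hdot U U -> hdot U w = 0 ->
  hdot (orthoproj2 U E x - orthoproj2 (U + w) E x)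
       (orthoproj2 U E x - orthoproj2 (U + w) E x) <=
    2 * hdot w w / hdot (U + w) (U + w) * hdot x x.
Proof.
set D := orthoproj2 U E x - _; move=> U0 Uw; have w0 := hdotxx_ge0 w.
have aP := hdot_Cauchy_Schwarz x U; have bP := hdot_Cauchy_Schwarz x w.
have -> : hdot (U + w) (U + w) = hdot U U + hdot w w.
  by rewrite !hdotE (hdotC w U) Uw; ring.
have DE : D = (hdot x U / hdot U U
      - (hdot x U + hdot x w) / (hdot U U + hdot w w)) *: U
    - ((hdot x U + hdot x w) / (hdot U U + hdot w w)) *: w.
  rewrite /D /orthoproj2 !hdotE (hdotC w U) Uw addr0 add0r.
  by rewrite opprD addrACA subrr addr0 scalerDr opprD addrA -scalerBl.
rewrite {}DE !hdotE (hdotC w U) Uw.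
move: (hdot U U) (hdot w w) (hdot x U) (hdot x w) (hdot x x) U0 w0 aP bP.
move=> u d a b n u0 d0 aP bP.
have ud0 : 0 < u + d by lra.
have -> (y z v t : R) : y * (z * u - v * 0) - t * (z * 0 - v * d) =
    y * z * u + t * v * d by ring.
set l := (X in X <= _).
have -> : l = (a ^+ 2 / u * d + b ^+ 2) / (u + d).
  by rewrite /l; field; rewrite !gt_eqF.
rewrite [leRHS]mulrAC ler_pM2r ?invr_gt0//.
have : a ^+ 2 / u <= n by rewrite ler_pdivrMr.
(* The factor 2 counts two terms, [m * d] and [b ^+ 2], each at most [n * d]. *)
move: (a ^+ 2 / u) => m mn; nra.
Qed.

(** Squeeze between 0 and the square root of |c_k|; the absolute value is there because [c] carries
    no sign hypothesis. *)
Lemma opnorm_cvg0 (T : nat -> lieH R -> lieH R) (c : nat -> R) :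
  (forall k x, hdot (T k x) (T k x) <= c k * hdot x x) ->
  c k @[k --> \oo] --> 0 -> opnorm (T k) @[k --> \oo] --> 0%E.
Proof.
move=> Tc c0.
apply: (@squeeze_cvge _ _ _ _ (cst 0%E) _ (fun k => (Num.sqrt `|c k|)%:E)).
- apply: nearW => k; apply/andP; split.
    (* The unit ball contains 0, so the supremum is at least one nonnegative number. *)
    apply: (@le_trans _ _ (hnorm (T k 0))%:E).
      by rewrite lee_fin sqrtr_ge0.
    apply: ereal_sup_ubound; exists 0 => //=.
    by rewrite /hnorm /hdot !l2_dot0l mul0r !addr0 sqrtr0.
  apply: ge_ereal_sup => _ [x /= x1 <-]; rewrite lee_fin; apply: ler_wsqrtr.
  apply: le_trans (Tc k x) _; rewrite -[leRHS]mulr1.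
  apply: le_trans (_ : `|c k| * hdot x x <= _).
    by apply: ler_wpM2r; [exact: hdotxx_ge0|exact: ler_norm].
  by apply: ler_wpM2l => //; rewrite -ler_sqrt ?ler01// sqrtr1.
- exact: cvg_cst.
- apply: cvg_EFin; first exact: nearW.
  rewrite -(@sqrtr0 R); apply: continuous_cvg; first exact: sqrt_continuous.
  by rewrite -(@normr0 R R); exact: cvg_norm.
Qed.

End Planes.

(** * Sums of inverse powers *)

Section PowerSums.
Context {R : realType}.

(** The constant 2 alone is not inductive. With the correction 2/(k+1), the induction step gains
    exactly k / ((k+1)^2 (k+2)) >= 0. *)
Lemma sum_inv_sqr_le (k : nat) :
  \sum_(0 <= j < k) j.+1%:R ^- 2 <= 2 - 2 / k.+1%:R :> R.
Proof.
elim: k => [|k IH]; first by rewrite big_nil divr1 subrr.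
rewrite big_nat_recr//=; apply: le_trans (lerD IH (lexx _)) _.
rewrite -[k.+2]addn1 -[k.+1]addn1 !natrD -subr_ge0.
have k0 : 0 <= k%:R :> R by [].
move: (k%:R : R) k0 => t t0.
rewrite (_ : _ - _ = t / ((t + 1) ^+ 2 * (t + 1 + 1))).
  by rewrite divr_ge0// mulr_ge0 ?exprn_ge0//; lra.
by field; apply/andP; split; rewrite gt_eqF//; lra.
Qed.

Lemma sum_inv_cube_le (k : nat) : \sum_(0 <= j < k) j.+1%:R ^- 3 <= 2 :> R.
Proof.
apply: le_trans (_ : \sum_(0 <= j < k) j.+1%:R ^- 2 <= _).
  apply: ler_sum => j _.
  by rewrite lef_pV2 ?posrE ?exprn_gt0// ler_weXn2l ?ler1n.
apply: le_trans (sum_inv_sqr_le k) _.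
by rewrite gerBl divr_ge0.
Qed.

(** The first term is already 1. For k = 0 the sum is empty and [W] is 0, hence the restriction to
    positive k. *)
Lemma sum_inv_cube_ge1 (k : nat) : (0 < k)%N ->
  1 <= \sum_(0 <= j < k) j.+1%:R ^- 3 :> R.
Proof.
case: k => // k _; rewrite big_nat_recl//= expr1n invr1 lerDl.
by apply: sumr_ge0 => j _; rewrite invr_ge0 exprn_ge0.
Qed.

Lemma lim_sum_inv_cube_gt0 : 0 < limn (series (fun j => j.+1%:R ^- 3 : R)).
Proof.
have nd : nondecreasing_seq (series (fun j => j.+1%:R ^- 3 : R)).
  by apply: nondecreasing_series => j _ _; rewrite invr_ge0 exprn_ge0.
apply: lt_le_trans ltr01 _; apply: le_trans (sum_inv_cube_ge1 1%N isT) _.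
apply: (nondecreasing_cvgn_le nd); apply: nondecreasing_is_cvgn => //.
by exists 2 => _ [k _ <-]; exact: sum_inv_cube_le.
Qed.

Lemma harmonic_square_summable :
  (fun i => i.+1%:R^-1 : R^o) \in @square_summable R.
Proof.
apply/square_summableP; apply: nondecreasing_is_cvgn.
  by apply: nondecreasing_series => j _ _; rewrite sqr_ge0.
exists 2 => _ [k _ <-]; rewrite /series/=.
under eq_bigr do rewrite exprVn.
by apply: le_trans (sum_inv_sqr_le k) _; rewrite gerBl divr_ge0.
Qed.

Definition harmonic_l2 : l2 R := L2 harmonic_square_summable.

Lemma cvg_harmonic_y : series (@harmonic R) n @[n --> \oo] --> +oo.
Proof.
apply: nondecreasing_dvgn_lt; last exact: dvg_harmonic.
by apply: nondecreasing_series => j _ _; exact: harmonic_ge0.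
Qed.

End PowerSums.

(** * Finitely supported sequences, and uniqueness of B *)

Section PartialSums.
Context {R : realType}.
Implicit Types a b : nat -> R.

Definition l2_trunc a (k : nat) : l2 R := \sum_(0 <= j < k) a j *: l2_basis j.

Lemma sum_e1E a k : \sum_(0 <= j < k) a j *: e1 R j = (l2_trunc a k, 0, 0).
Proof.
rewrite /l2_trunc; elim: k => [|k IH]; first by rewrite !big_nil.
rewrite !big_nat_recr//= IH /e1.
by congr (_, _, _) => /=; rewrite scaler0 addr0.
Qed.

Lemma l2_truncZ (c : R) a k :
  c *: l2_trunc a k = l2_trunc (fun j => c * a j) k.
Proof.
by rewrite /l2_trunc scaler_sumr; apply: eq_bigr => j _; rewrite scalerA.
Qed.

Lemma l2_dot_trunc a k x :
  l2_dot (l2_trunc a k) x = \sum_(0 <= j < k) a j * x j.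
Proof.
rewrite (@l2_dot_finite _ k).
  by apply: eq_big_nat => j /= jk; rewrite l2_sum_basisE jk.
by move=> j; rewrite l2_sum_basisE leqNgt => /negPf ->; rewrite mul0r.
Qed.

Lemma l2_dot_trunc2 a b k :
  l2_dot (l2_trunc a k) (l2_trunc b k) = \sum_(0 <= j < k) a j * b j.
Proof.
by rewrite l2_dot_trunc; apply: eq_big_nat => j /= jk; rewrite l2_sum_basisE jk.
Qed.

Lemma opA_trunc a k : opA (l2_trunc a k) = l2_trunc (fun j => a j / j.+1%:R) k.
Proof.
apply: l2P => j /=; rewrite !l2_sum_basisE.
by case: ifP => // _; rewrite mul0r.
Qed.

Lemma opA0 : opA 0 = 0 :> l2 R.
Proof. by apply: l2P => j; exact: mul0r. Qed.

Lemma l2_dot_opA_basis j (x : l2 R) :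
  l2_dot (opA (l2_basis j)) x = x j / j.+1%:R.
Proof.
(* Seen as a truncation of length [j.+1], the basis vector falls under the finite-sum formulas, and
   only the last term survives. *)
have -> : @l2_basis R j = l2_trunc (fun i => (i == j)%:R) j.+1.
  apply: l2P => i /=; rewrite l2_sum_basisE.
  by case: eqVneq => [->|_]; [rewrite ltnSn|case: ifP].
rewrite opA_trunc l2_dot_trunc big_nat_recr//= eqxx big1_seq.
  by rewrite add0r mul1r mulrC.
move=> i /=; rewrite mem_index_iota => /= ij.
by rewrite ltn_eqF// !mul0r.
Qed.

(** Although weak, the metric separates points: testing against e^1_j, e^2_j and e^3 recovers every
    coordinate, up to the nonzero weight 1/(j+1) for the first two families. *)
Lemma sigma_nondegenerate (b c : lieH R) :
  (forall Z, sigma Z b = sigma Z c) -> b = c.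
Proof.
case: b => -[b1 b2] b3; case: c => -[c1 c2] c3 bc.
have n0 j : j.+1%:R != 0 :> R by rewrite pnatr_eq0.
congr (_, _, _).
- apply: l2P => j; have := bc (l2_basis j, 0, 0); rewrite /sigma/=.
  by rewrite !opA0 !l2_dot0l !mul0r !addr0 !l2_dot_opA_basis => /divIf; exact.
- apply: l2P => j; have := bc (0, l2_basis j, 0); rewrite /sigma/=.
  rewrite !opA0 !l2_dot0l !mul0r !addr0 !add0r !l2_dot_opA_basis.
  by move/divIf; exact.
- have := bc (0, 0, 1); rewrite /sigma/=.
  by rewrite !opA0 !l2_dot0l !add0r !mul1r.
Qed.

(** Nondegeneracy gives uniqueness, so exhibiting any solution computes the chosen value [B]. *)
Lemma is_B_eq (X Y b : lieH R) : is_B X Y b -> B X Y = b.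
Proof.
move=> Xb; apply: sigma_nondegenerate => Z.
rewrite -Xb; symmetry; apply: (@xgetPex _ 0 [set b | is_B X Y b]).
by exists b.
Qed.

End PartialSums.

(** * Orthonormality and curvature of the planes span(W_k, e3) *)

Section Witness.
Context {R : realType}.

Definition W_scale (k : nat) : R :=
  (Num.sqrt (\sum_(0 <= j < k) j.+1%:R ^- 3))^-1.

Lemma W_scale_sqr k :
  W_scale k ^+ 2 = (\sum_(0 <= j < k) j.+1%:R ^- 3)^-1.
Proof.
rewrite exprVn sqr_sqrtr//.
by apply: sumr_ge0 => j _; rewrite invr_ge0 exprn_ge0.
Qed.

Lemma W_scale_neq0 k : (0 < k)%N -> W_scale k != 0.
Proof.
move=> k0; rewrite invr_eq0 sqrtr_eq0 -ltNge.
exact: lt_le_trans ltr01 (sum_inv_cube_ge1 k k0).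
Qed.

Lemma WE k : W R k = (l2_trunc (fun j => W_scale k / j.+1%:R) k, 0, 0).
Proof.
rewrite /W sum_e1E -/(W_scale k) -l2_truncZ.
by congr (_, _, _); rewrite scaler0.
Qed.

Lemma sigma_orthonormal_W k : (0 < k)%N -> sigma_orthonormal (W R k) (e3 R).
Proof.
move=> k0; rewrite WE; split; rewrite /sigma/= ?opA0 ?l2_dot0l ?l2_dot0r.
- rewrite mul0r !addr0 opA_trunc l2_dot_trunc2.
  (* Two factors 1/(j+1) come from [W] and a third one from [opA], whence the cubes. *)
  under eq_bigr => j _.
    rewrite (_ : _ * _ = W_scale k ^+ 2 * j.+1%:R ^- 3); last first.
      by field; rewrite nat1r pnatr_eq0.
    over.
  rewrite -mulr_sumr W_scale_sqr mulVf// gt_eqF//.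
  exact: lt_le_trans ltr01 (sum_inv_cube_ge1 k k0).
- by rewrite !add0r mulr1.
- by rewrite mul0r !addr0.
Qed.

Lemma bracketX0 (X Y : lieH R) : X.1 = 0 -> bracket X Y = 0.
Proof.
by move=> X0; rewrite /bracket X0 !l2_dot0l subrr mulr0 scale0r.
Qed.

Lemma bracket0X (X Y : lieH R) : Y.1 = 0 -> bracket X Y = 0.
Proof.
by move=> Y0; rewrite /bracket Y0 !l2_dot0r subrr mulr0 scale0r.
Qed.

Lemma sigma_0l (Z : lieH R) : sigma 0 Z = 0.
Proof. by rewrite /sigma/= !opA0 !l2_dot0l mul0r !addr0. Qed.

Lemma sigma_0r (Z : lieH R) : sigma Z 0 = 0.
Proof. by rewrite /sigma/= !l2_dot0r mulr0 !addr0. Qed.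

Lemma sigma_e3l (t : R) (Z : lieH R) : sigma (t *: e3 R) Z = t * Z.2.
Proof.
rewrite /sigma/= !scaler0 !opA0 !l2_dot0l !add0r.
by change (t * 1 * Z.2 = t * Z.2); rewrite mulr1.
Qed.

Lemma is_B_e3r (X : lieH R) : is_B X (e3 R) 0.
Proof. by move=> Z; rewrite bracketX0// sigma_0l sigma_0r. Qed.

(** Brackets are multiples of [e3], which is sigma-orthogonal to [W]. *)
Lemma is_B_W_W k : is_B (W R k) (W R k) 0.
Proof. by move=> Z; rewrite sigma_e3l sigma_0r WE mulr0. Qed.

(* The second component is [2 A^-1 W_k]; at k = infinity it leaves l^2. *)
Lemma is_B_e3_W k :
  is_B (e3 R) (W R k) (0, l2_trunc (fun=> 2 * W_scale k) k, 0).
Proof.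
move=> Z; rewrite sigma_e3l WE /sigma /= !l2_dot0l !l2_dot0r mulr0 mulr1.
rewrite subr0 addr0 add0r [RHS]l2_dotC !l2_dot_trunc mulr_sumr.
by apply: eq_bigr => j _ /=; field; rewrite nat1r pnatr_eq0.
Qed.

Lemma sectional_curvature_W k :
  sectional_curvature (W R k) (e3 R) = W_scale k ^+ 2 * series harmonic k.
Proof.
rewrite /sectional_curvature (is_B_eq _ _ _ (is_B_e3r _)).
rewrite (is_B_eq _ _ _ (is_B_W_W k)) (is_B_eq _ _ _ (is_B_e3r _)).
rewrite (is_B_eq _ _ _ (is_B_e3_W k)) bracket0X//.
(* Here alpha, B_X and B_Y vanish, so only <delta, delta> is left, with delta half of B(e3, W_k). *)
rewrite !scaler0 !sigma_0l !mulr0 !subr0 addr0 add0r.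
rewrite /sigma/= !scaler0 opA0 l2_dot0l mulr0 addr0 add0r.
rewrite l2_truncZ opA_trunc l2_dot_trunc2 /series/= mulr_sumr.
by apply: eq_bigr => j _; field; rewrite nat1r pnatr_eq0.
Qed.

Lemma sectional_curvature_defined_W k : (0 < k)%N ->
  sectional_curvature_defined (W R k) (e3 R).
Proof.
move=> k0; split; first exact: sigma_orthonormal_W.
split; eexists; [exact: is_B_e3r|exact: is_B_e3_W|exact: is_B_W_W|
  exact: is_B_e3r].
Qed.

Lemma cvg_sectional_curvature_W :
  sectional_curvature (W R k) (e3 R) @[k --> \oo] --> +oo.
Proof.
apply/cvgryPge => A; near=> k; rewrite sectional_curvature_W W_scale_sqr mulrC.
have s1 : 1 <= \sum_(0 <= j < k) j.+1%:R ^- 3 :> R.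
  by apply: sum_inv_cube_ge1; near: k; exists 1%N.
(* The cube sum in the denominator is at most 2, so it suffices that the harmonic sum exceeds 2|A|;
   |A| keeps the comparison valid for negative A. *)
have hA : `|A| * 2 <= series (@harmonic R) k.
  by near: k; move/cvgryPge: (@cvg_harmonic_y R); exact.
rewrite ler_pdivlMr; last exact: lt_le_trans ltr01 s1.
apply: le_trans hA; apply: le_trans (ler_wpM2r _ (ler_norm A)) _; first by lra.
by apply: ler_wpM2l => //; exact: sum_inv_cube_le.
Unshelve. all: by end_near. Qed.

(** * Convergence of the planes, through the unnormalised directions *)

Definition Wdir (k : nat) : lieH R := (l2_trunc harmonic k, 0, 0).
Definition Wdir_infty : lieH R := (harmonic_l2, 0, 0).

Lemma hdot_e3r (Z : lieH R) : hdot Z (e3 R) = Z.2.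
Proof. by rewrite /hdot /= !l2_dot0r !add0r mulr1. Qed.

Lemma hdot_Wdirl k (Z : lieH R) :
  hdot (Wdir k) Z = \sum_(0 <= j < k) harmonic j * Z.1.1 j.
Proof. by rewrite /hdot/= l2_dot0l mul0r !addr0 l2_dot_trunc. Qed.

Lemma hdot_Wdir k : hdot (Wdir k) (Wdir k) =
  series (fun j => harmonic j * harmonic j) k.
Proof. by rewrite /hdot/= l2_dot0l mul0r !addr0 l2_dot_trunc2. Qed.

(** Pairing with [Wdir k] sees only the first k coordinates, where both sequences agree. The tail is
    therefore orthogonal to [Wdir k], as [orthoproj2_diff_le] requires. *)
Lemma hdot_Wdir_infty k : hdot (Wdir k) Wdir_infty = hdot (Wdir k) (Wdir k).
Proof. by rewrite hdot_Wdir hdot_Wdirl. Qed.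

Lemma hdot_Wdir_tail k : hdot (Wdir k) (Wdir_infty - Wdir k) = 0.
Proof. by rewrite hdotDr hdotNr hdot_Wdir_infty subrr. Qed.

(** By Pythagoras the squared norm of the tail is the sum of 1/j^2 minus its k-th partial sum. *)
Lemma hdot_tail_cvg0 :
  hdot (Wdir_infty - Wdir k) (Wdir_infty - Wdir k) @[k --> \oo] --> (0 : R).
Proof.
rewrite (_ : (fun k => _) =
    fun k => hdot Wdir_infty Wdir_infty - hdot (Wdir k) (Wdir k)).
  rewrite -(subrr (hdot Wdir_infty Wdir_infty)).
  apply: cvgB; first exact: cvg_cst.
  under eq_fun do rewrite hdot_Wdir.
  rewrite /hdot/= l2_dot0l mul0r !addr0.
  exact: (is_cvg_l2_dot harmonic_l2 harmonic_l2).
apply/funext => k.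
by rewrite !hdotDl !hdotNl hdot_Wdir_tail subr0 hdotDr hdotNr
  (hdotC Wdir_infty (Wdir k)) hdot_Wdir_infty.
Qed.

Lemma hsum_e1E : hsum (fun j => j.+1%:R^-1 *: e1 R j) = Wdir_infty.
Proof.
apply: hsum_eq.
under eq_fun do rewrite sum_e1E.
apply/hnorm_cvg0; have := hdot_tail_cvg0.
by under eq_fun do rewrite -opprB hdotNl hdotNr opprK.
Qed.

Lemma span2_WE k : (0 < k)%N -> span2 (W R k) (e3 R) = span2 (Wdir k) (e3 R).
Proof. by move=> k0; rewrite /W sum_e1E span2Zl ?W_scale_neq0. Qed.

Lemma span2_WinftyE : span2 (Winfty R) (e3 R) = span2 Wdir_infty (e3 R).
Proof.
rewrite /Winfty hsum_e1E span2Zl// invr_eq0 sqrtr_eq0 -ltNge.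
exact: lim_sum_inv_cube_gt0.
Qed.

(** The index is shifted because [W R 0] is 0 and does not span a plane with [e3]. *)
Lemma Gr2_cvg_span_W :
  Gr2_cvg (fun k : nat => span2 (W R k.+1) (e3 R)) (span2 (Winfty R) (e3 R)).
Proof.
have U0 k : 0 < hdot (Wdir k.+1) (Wdir k.+1).
  rewrite hdot_Wdirl; apply: lt_le_trans ltr01 _.
  rewrite big_nat_recl//= l2_sum_basisE /= invr1 mulr1 lerDl.
  apply: sumr_ge0 => j _; rewrite l2_sum_basisE.
  by case: ifP => _; rewrite ?mulr0// mulr_ge0 ?harmonic_ge0.
(* This splitting into truncation plus tail puts the limit direction in the form [U + w] of
   [orthoproj2_diff_le]. *)
have UV k : Wdir_infty = Wdir k + (Wdir_infty - Wdir k) by rewrite addrC subrK.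
have V0 : 0 < hdot Wdir_infty Wdir_infty.
  apply: lt_le_trans ltr01 _; have := l2_dotxx_ge_sqr (@harmonic_l2 R) 0.
  by rewrite /hdot/= l2_dot0l mul0r !addr0 invr1 expr1n.
have Un0 k : hdot (Wdir k.+1) (Wdir k.+1) != 0 by rewrite gt_eqF.
have Vn0 : hdot Wdir_infty Wdir_infty != 0 by rewrite gt_eqF.
have e31 : hdot (e3 R) (e3 R) = 1 by rewrite hdot_e3r.
have Ue k : hdot (Wdir k) (e3 R) = 0 by rewrite hdot_e3r.
have Ve : hdot Wdir_infty (e3 R) = 0 by rewrite hdot_e3r.
rewrite span2_WinftyE; under [X in Gr2_cvg X]eq_fun do rewrite span2_WE//.
split=> [k||].
- by exists (Wdir k.+1), (e3 R); split => //; exact: orthogonal_lin_indep2.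
- by exists Wdir_infty, (e3 R); split => //; exact: orthogonal_lin_indep2.
exists (fun k => orthoproj2 (Wdir k.+1) (e3 R)).
exists (orthoproj2 Wdir_infty (e3 R)); split.
- by move=> k; exact: orthoproj2P.
- exact: orthoproj2P.
(* The squared norm of the tail controls the projections: the squared operator norm is at most 2 d /
   |Wdir_infty|^2. *)
pose d k := hdot (Wdir_infty - Wdir k) (Wdir_infty - Wdir k).
apply: (@opnorm_cvg0 _ _ (fun k => 2 * d k.+1 / hdot Wdir_infty Wdir_infty)).
  move=> k x.
  have := orthoproj2_diff_le _ _ (e3 R) x (U0 k) (hdot_Wdir_tail k.+1).
  by rewrite -UV.
rewrite (_ : 0 = 2 * 0 / hdot Wdir_infty Wdir_infty); last first.
  by rewrite mulr0 mul0r.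
apply: cvgM; last exact: cvg_cst.
apply: cvgM; first exact: cvg_cst.
by rewrite (cvg_shiftS d); exact: hdot_tail_cvg0.
Qed.

End Witness.

Theorem proposition4p2 (R : realType) :
  [/\ forall k : nat, (1 <= k)%N -> sigma_orthonormal (W R k) (e3 R),
      Gr2_cvg (fun k : nat => span2 (W R k.+1) (e3 R))
              (span2 (Winfty R) (e3 R)),
      forall k : nat, (1 <= k)%N ->
        sectional_curvature_defined (W R k) (e3 R) &
      sectional_curvature (W R k) (e3 R) @[k --> \oo] --> +oo].
Proof.
split.
- exact: sigma_orthonormal_W.
- exact: Gr2_cvg_span_W.
- exact: sectional_curvature_defined_W.
- exact: cvg_sectional_curvature_W.
Qed.
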